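(* Let $(A,m,u,\Delta,\varepsilon,\Phi,S)$ be a quasi-bialgebra with preantipode over a field $\Bbbk$ and let $M$ be a quasi-Hopf $A$-bimodule. Consider $N:=M^{\mathrm{co}A}$ as a left $A$-module with $A$-action $a\blacktriangleright n=\tau(a\cdot n)$, and consider $N\otimes A$ as a quasi-Hopf $A$-bimodule with $a\cdot(n\otimes b)=(a_1\blacktriangleright n)\otimes a_2b$, $(n\otimes b)\cdot a=n\otimes ba$, and coaction $\rho(n\otimes b)=(\phi^1\blacktriangleright n)\otimes\phi^2b_1\otimes\phi^3b_2$. Then $\nu\colon N\otimes A\to M$, $n\otimes a\mapsto n\cdot a$, is an isomorphism of quasi-Hopf $A$-bimodules with inverse given by $\nu^{-1}(m)=\tau(m_0)\otimes m_1$.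
   Context: $\Bbbk$ is a field, $\otimes=\otimes_\Bbbk$; Sweedler notation $\Delta(a)=a_1\otimes a_2$, $\rho(m)=m_0\otimes m_1$ (summation understood). Quasi-bialgebra: $(A,m,u)$ is an associative unital $\Bbbk$-algebra, $\Delta\colon A\to A\otimes A$ and $\varepsilon\colon A\to\Bbbk$ are algebra maps, $\Phi=\Phi^1\otimes\Phi^2\otimes\Phi^3\in A\otimes A\otimes A$ is invertible with inverse $\Phi^{-1}=\phi^1\otimes\phi^2\otimes\phi^3$, and, writing $A$ for $\mathrm{Id}_A$: $(A\otimes A\otimes\Delta)(\Phi)\cdot(\Delta\otimes A\otimes A)(\Phi)=(1\otimes\Phi)\cdot(A\otimes\Delta\otimes A)(\Phi)\cdot(\Phi\otimes1)$; $(\varepsilon\otimes A\otimes A)(\Phi)=(A\otimes\varepsilon\otimes A)(\Phi)=(A\otimes A\otimes\varepsilon)(\Phi)=1\otimes1$; $(A\otimes\Delta)(\Delta(a))\cdot\Phi=\Phi\cdot(\Delta\otimes A)(\Delta(a))$; $\varepsilon(a_1)a_2=a=a_1\varepsilon(a_2)$ for all $a\in A$. A (right) quasi-Hopf $A$-bimodule is an $(A,A)$-bimodule $M$ with a $\Bbbk$-linear coaction $\rho\colon M\to M\otimes A$ such that $\rho(a\cdot m\cdot b)=a_1\cdot m_0\cdot b_1\otimes a_2m_1b_2$, $m_0\,\varepsilon(m_1)=m$, and $(m_0\otimes(m_1)_1\otimes(m_1)_2)\cdot\Phi=\Phi\cdot((m_0)_0\otimes(m_0)_1\otimes m_1)$.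 Morphisms are $A$-bilinear, colinear maps. A preantipode for $A$ is a $\Bbbk$-linear map $S\colon A\to A$ such that, for all $a,b\in A$, $a_1S(ba_2)=\varepsilon(a)S(b)$, $S(a_1b)a_2=\varepsilon(a)S(b)$, and $\Phi^1S(\Phi^2)\Phi^3=1$. For a quasi-Hopf bimodule $M$, $\tau\colon M\to M$ is $\tau(m)=\Phi^1\cdot m_0\cdot S(\Phi^2m_1)\Phi^3$, and the space of coinvariant elements is $M^{\mathrm{co}A}:=\tau(M)$; it is a left $A$-module via $a\blacktriangleright n:=\tau(a\cdot n)$. *)

(* Defs.v *)
From HB Require Import structures.
From mathcomp Require Import all_boot all_order all_algebra.
From mathcomp Require Import boolp classical_sets.

Set Implicit Arguments.
Unset Strict Implicit.
Unset Printing Implicit Defensive.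

Import GRing.Theory.
Local Open Scope ring_scope.
Local Open Scope quotient_scope.

Notation bilin f := (bilinear_for *:%R *:%R f).

Section LinearFacts.
Variables (k : fieldType) (U V : lmodType k) (f : U -> V).
Hypothesis fL : linear f.

Lemma lin0 : f 0 = 0.
Proof. by have := fL (-1) 0 0; rewrite scaler0 addr0 scaleN1r addNr. Qed.

Lemma linD u v : f (u + v) = f u + f v.
Proof. by have := fL 1 u v; rewrite !scale1r. Qed.

Lemma linZ c u : f (c *: u) = c *: f u.
Proof. by have := fL c u 0; rewrite lin0 !addr0. Qed.

End LinearFacts.

Section Tensor.
Variables (k : fieldType) (U V : lmodType k).
Local Notation fsum := (seq (U * V)).

(* A sequence [:: (u_1, v_1); ...; (u_n, v_n)] stands for the formal sum of
   the u_i (x) v_i; [teq] is the congruence generated by the usual relations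
   on the free commutative monoid over U * V.  The quotient is a group because
   (- u, v) is then an inverse of (u, v).                                     *)
Inductive teq : fsum -> fsum -> Prop :=
| teq_perm s t of perm_eq s t : teq s t
| teq_sym s t of teq s t : teq t s
| teq_trans s t r of teq s t & teq t r : teq s r
| teq_cat r s t of teq s t : teq (r ++ s) (r ++ t)
| teq_0 v : teq [:: (0, v)] [::]
| teq_Dl u u' v : teq [:: (u + u', v)] [:: (u, v); (u', v)]
| teq_Dr u v v' : teq [:: (u, v + v')] [:: (u, v); (u, v')]
| teq_Z c u v : teq [:: (c *: u, v)] [:: (u, c *: v)].

Definition teqb : rel fsum := fun s t => `[< teq s t >].

Lemma teqb_refl : reflexive teqb.
Proof. by move=> s; apply/asboolP/teq_perm. Qed.
Lemma teqb_sym : symmetric teqb.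
Proof. by move=> s t; apply/asboolP/asboolP => /teq_sym. Qed.
Lemma teqb_trans : transitive teqb.
Proof.
by move=> t s r /asboolP st /asboolP tr; apply/asboolP; apply: teq_trans st tr.
Qed.

Canonical teq_equiv : equiv_rel fsum := EquivRel teqb teqb_refl teqb_sym teqb_trans.

Definition tensor : Type := {eq_quot teq_equiv}.
HB.instance Definition _ := Choice.copy tensor {eq_quot teq_equiv}.
HB.instance Definition _ := EqQuotient.copy tensor {eq_quot teq_equiv}.

Definition tens_seq (s : fsum) : tensor := \pi_tensor s.
Definition tens (u : U) (v : V) : tensor := tens_seq [:: (u, v)].

Lemma tens_seqP s t : tens_seq s = tens_seq t <-> teq s t.
Proof.
split=> [/eqP|st]; first by rewrite eqmodE => /asboolP.
by apply/eqP; rewrite eqmodE; apply/asboolP.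
Qed.

Lemma tens_seqK t : tens_seq (repr t) = t.
Proof. exact: reprK. Qed.

Lemma teq_repr s : teq (repr (tens_seq s)) s.
Proof. by apply/tens_seqP; rewrite tens_seqK. Qed.

Lemma teq_cat2 s s' t t' : teq s s' -> teq t t' -> teq (s ++ t) (s' ++ t').
Proof.
move=> ss' tt'; apply: teq_trans (teq_cat s tt') _.
apply: teq_trans (teq_perm (_ : perm_eq _ (t' ++ s))) _; first by rewrite perm_catC.
by apply: teq_trans (teq_cat t' ss') _; apply: teq_perm; rewrite perm_catC.
Qed.

Definition fscale (c : k) (s : fsum) : fsum := [seq (c *: p.1, p.2) | p <- s].

Lemma teq_fscale c s t : teq s t -> teq (fscale c s) (fscale c t).
Proof.
elim=> {s t} [s t st|s t _ /teq_sym//|s t r _ st _ /(teq_trans st)//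
  |r s t _ st|v|u u' v|u v v'|d u v] /=.
- exact/teq_perm/perm_map.
- by rewrite /fscale !map_cat; apply: teq_cat.
- by rewrite scaler0; apply: teq_0.
- by rewrite scalerDr; apply: teq_Dl.
- exact: teq_Dr.
- by rewrite scalerA mulrC -scalerA; apply: teq_Z.
Qed.

Definition tensor_zero : tensor := tens_seq [::].
Definition tensor_add (x y : tensor) : tensor := tens_seq (repr x ++ repr y).
Definition tensor_scale c (x : tensor) : tensor := tens_seq (fscale c (repr x)).
Definition tensor_opp (x : tensor) : tensor := tensor_scale (-1) x.

Lemma tensor_addE s t : tensor_add (tens_seq s) (tens_seq t) = tens_seq (s ++ t).
Proof. by apply/tens_seqP/teq_cat2; apply: teq_repr. Qed.

Lemma tensor_scaleE c s : tensor_scale c (tens_seq s) = tens_seq (fscale c s).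
Proof. by apply/tens_seqP/teq_fscale/teq_repr. Qed.

Lemma tens_seq_ind (P : tensor -> Prop) : (forall s, P (tens_seq s)) -> forall x, P x.
Proof. by move=> Ps x; rewrite -[x]tens_seqK. Qed.

Lemma tensor_addA : associative tensor_add.
Proof.
elim/tens_seq_ind=> s; elim/tens_seq_ind=> t; elim/tens_seq_ind=> r.
by rewrite !tensor_addE catA.
Qed.

Lemma tensor_addC : commutative tensor_add.
Proof.
elim/tens_seq_ind=> s; elim/tens_seq_ind=> t; rewrite !tensor_addE.
by apply/tens_seqP/teq_perm; rewrite perm_catC.
Qed.

Lemma tensor_add0 : left_id tensor_zero tensor_add.
Proof. by elim/tens_seq_ind=> s; rewrite tensor_addE. Qed.

Lemma tensor_scaleDl x :
  {morph tensor_scale^~ x : a b / a + b >-> tensor_add a b}.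
Proof.
elim/tens_seq_ind: x => s a b; rewrite !tensor_scaleE tensor_addE.
apply/tens_seqP; elim: s => [|p s IHs] /=; first exact: teq_perm.
rewrite -cat1s; apply: (teq_trans (teq_cat2 (t' := _ ++ _) _ IHs)).
  by rewrite scalerDl; apply: teq_Dl.
by apply: teq_perm; rewrite /= perm_cons (perm_catCA [:: _] (fscale a s)).
Qed.

Lemma tensor_scale0 x : tensor_scale 0 x = tensor_zero.
Proof.
elim/tens_seq_ind: x => s; rewrite tensor_scaleE; apply/tens_seqP.
elim: s => [|p s IHs] /=; first exact: teq_perm.
rewrite -[[::]]/([::] ++ [::]) -cat1s scale0r.
exact: teq_cat2 (teq_0 _) IHs.
Qed.

Lemma tensor_scale1 : left_id 1 tensor_scale.
Proof.
elim/tens_seq_ind=> s; rewrite tensor_scaleE; congr tens_seq.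
by rewrite -[RHS]map_id; apply: eq_map => -[u v] /=; rewrite scale1r.
Qed.

Lemma tensor_addN : left_inverse tensor_zero tensor_opp tensor_add.
Proof.
move=> x; rewrite -{2}[x]tensor_scale1 /tensor_opp -tensor_scaleDl.
by rewrite addNr tensor_scale0.
Qed.

Lemma tensor_scaleA a b x : tensor_scale a (tensor_scale b x) = tensor_scale (a * b) x.
Proof.
elim/tens_seq_ind: x => s; rewrite !tensor_scaleE; congr tens_seq.
by rewrite /fscale -map_comp; apply: eq_map => p /=; rewrite scalerA.
Qed.

Lemma tensor_scaleDr : right_distributive tensor_scale tensor_add.
Proof.
move=> a; elim/tens_seq_ind=> s; elim/tens_seq_ind=> t.
by rewrite !(tensor_scaleE, tensor_addE) /fscale map_cat.
Qed.

HB.instance Definition _ := GRing.isZmodule.Build tensor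
  tensor_addA tensor_addC tensor_add0 tensor_addN.
HB.instance Definition _ := GRing.Zmodule_isLmodule.Build k tensor
  tensor_scaleA tensor_scale1 tensor_scaleDr tensor_scaleDl.

Lemma tens_bilin : bilin tens.
Proof.
split=> [v c u u'|u c v v'] /=.
  change (tens (c *: u + u') v =
    tensor_add (tensor_scale c (tens u v)) (tens u' v)).
  by rewrite tensor_scaleE tensor_addE; apply/tens_seqP/teq_Dl.
change (tens u (c *: v + v') =
  tensor_add (tensor_scale c (tens u v)) (tens u v')).
rewrite tensor_scaleE tensor_addE; apply/tens_seqP.
apply: teq_trans (teq_Dr _ _ _) _.
rewrite -cat1s -[fscale _ _ ++ _]/([:: (c *: u, v)] ++ [:: (u, v')]).
by apply: teq_cat2; [apply/teq_sym/teq_Z | apply: teq_perm].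
Qed.

Lemma tens_seqE s : tens_seq s = \sum_(p <- s) tens p.1 p.2.
Proof.
elim: s => [|[u v] s IHs]; first by rewrite big_nil.
by rewrite big_cons -IHs -[RHS]/(tensor_add _ _) tensor_addE.
Qed.

Lemma tensor_ind (P : tensor -> Prop) :
  P 0 -> (forall x y, P x -> P y -> P (x + y)) -> (forall u v, P (tens u v)) ->
  forall x, P x.
Proof.
by move=> P0 PD Pt; elim/tens_seq_ind=> s; rewrite tens_seqE; elim/big_ind: _.
Qed.

(* [tlift^~ f] is the linear map induced by f (Lemmas [tlift_linear],
   [tlift_tens] and [tlift_uniq]); it is meaningful only when f is bilinear,
   otherwise its value depends on the choice of representatives.              *)
Definition tlift (W : lmodType k) (t : tensor) (f : U -> V -> W) : W :=
  \sum_(p <- repr t) f p.1 p.2.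
Arguments tlift {W}.

Section Lift.
Variables (W : lmodType k) (f : U -> V -> W).
Hypothesis fL : bilin f.

Lemma teq_lift s t : teq s t ->
  \sum_(p <- s) f p.1 p.2 = \sum_(p <- t) f p.1 p.2.
Proof.
elim=> {s t} [s t st|s t _ ->//|s t r _ -> _ ->//|r s t _ st|v|u u' v|u v v'|c u v].
- exact: perm_big.
- by rewrite !big_cat /= st.
- by rewrite big_seq1 big_nil /= (lin0 (fL.1 v)).
- by rewrite !(big_cons, big_nil) /= !addr0 (linD (fL.1 v)).
- by rewrite !(big_cons, big_nil) /= !addr0 (linD (fL.2 u)).
- by rewrite !big_seq1 /= (linZ (fL.1 v)) (linZ (fL.2 u)).
Qed.

Lemma tlift_tens_seq s : tlift (tens_seq s) f = \sum_(p <- s) f p.1 p.2.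
Proof. exact/teq_lift/teq_repr. Qed.

Lemma tlift_tens u v : tlift (tens u v) f = f u v.
Proof. by rewrite /tens tlift_tens_seq big_seq1. Qed.

Lemma tlift_linear : linear (tlift^~ f).
Proof.
move=> c /=; elim/tens_seq_ind=> s; elim/tens_seq_ind=> t.
have -> : c *: tens_seq s + tens_seq t = tens_seq (fscale c s ++ t).
  by rewrite -[LHS]/(tensor_add (tensor_scale _ _) _) tensor_scaleE tensor_addE.
rewrite !tlift_tens_seq big_cat big_map scaler_sumr /=; congr (_ + _).
by apply: eq_bigr => p _; rewrite (linZ (fL.1 p.2)).
Qed.

Lemma tlift_uniq (g : {linear tensor -> W}) :
  (forall u v, g (tens u v) = f u v) -> g =1 tlift^~ f.
Proof.
move=> gE; elim/tens_seq_ind=> s /=; rewrite tlift_tens_seq tens_seqE linear_sum.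
by apply: eq_bigr => p _.
Qed.

End Lift.

Lemma tlift_funP (P W : lmodType k) (f : P -> U -> V -> W) (t : tensor) :
  (forall u v, linear (fun p => f p u v)) -> linear (fun p => tlift t (f p)).
Proof.
move=> fL c q q'; rewrite /tlift scaler_sumr -big_split /=.
by apply: eq_bigr => p _; rewrite fL.
Qed.

End Tensor.

Arguments tens {k U V}.
Arguments tlift {k U V W}.

Reserved Notation "x ⊗ y" (at level 45, left associativity).
Notation "U ⊗ V" := (tensor U%type V%type) : type_scope.
Notation "u ⊗ v" := (tens u v) : ring_scope.

(* Sweedler sums: for t = \sum_i u_i ⊗ v_i and a bilinear expression E of
   u and v, the sum of the E (u_i, v_i).  Triple tensors are bracketed to the
   left, and k ⊗ V is identified with V through scaling.                      *)
Notation "'Σ' [ u , v '<-' t ] E" := (tlift t (fun u v => E))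
  (at level 46, right associativity, u name, v name, E at level 46) : ring_scope.
Notation "'Σ' [ u , v , w '<-' t ] E" :=
  (tlift t (fun uv w => tlift uv (fun u v => E)))
  (at level 46, right associativity, u name, v name, w name, E at level 46) : ring_scope.

Section Separation.
Variables (k : fieldType) (V : lmodType k).
Local Open Scope classical_set_scope.

Lemma exists_functional (v0 : V) : v0 != 0 -> exists f : {linear V -> k^o}, f v0 = 1.
Proof.
move=> v0N0.
pose P (W : set V) := (forall c u v, W u -> W v -> W (c *: u + v)) /\ ~ W v0.
have [F FP totF|W [[WL Wv0] Wmax]] := @Zorn_bigcup V P.
  split=> [c u v [X FX Xu] [Y FY Yv]|[X FX]]; last by case: (FP X FX).
  have [XY|YX] := totF _ _ FX FY.
  - by exists Y => //; apply: (FP Y FY).1 => //; apply: XY.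
  - by exists X => //; apply: (FP X FX).1 => //; apply: YX.
have W0 : W 0.
  apply: contrapT => nW0; apply: (Wmax [set 0] _ _).
    split=> [u Wu|/(_ 0 erefl)//].
    by case: nW0; have := WL (-1) u u Wu Wu; rewrite scaleN1r addNr.
  split=> [c u v /= -> ->|/eqP]; first by rewrite scaler0 addr0.
  by rewrite (negPf v0N0).
have WZ c u : W u -> W (c *: u) by move=> Wu; rewrite -[_ *: _]addr0; apply: WL.
have WE x : exists c, W (x - c *: v0).
  have [Wx|nWx] := EM (W x); first by exists 0; rewrite scale0r subr0.
  pose W' := [set y | exists2 w, W w & exists a, y = w + a *: x].
  have : ~ P W'.
    apply: Wmax; split=> [w Ww|/(_ x) W'x].
      by exists w => //; exists 0; rewrite scale0r addr0.
    by apply/nWx/W'x; exists 0 => //; exists 1; rewrite add0r scale1r.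
  move=> nPW'; have [w Ww [a v0E]] : W' v0.
    apply: contrapT => nW'; apply: nPW'; split=> // c u v.
    move=> [w Ww [a ->]] [w' Ww' [a' ->]].
    exists (c *: w + w'); first exact: WL.
    by exists (c * a + a'); rewrite scalerDr addrACA scalerDl scalerA.
  have aN0 : a != 0.
    by apply/eqP => a0; apply: Wv0; rewrite v0E a0 scale0r addr0.
  exists a^-1; rewrite v0E scalerDr scalerA mulVf// scale1r opprD addrCA subrr addr0.
  by rewrite -scaleNr; apply: WZ.
pose f x : k^o := sval (cid (WE x)).
have fP x : W (x - f x *: v0) by rewrite /f; case: cid.
have f_uniq x c : W (x - c *: v0) -> f x = c.
  move=> Wc; apply/eqP; rewrite -subr_eq0; apply: contra_notT Wv0 => fcN0.
  have := WZ (f x - c)^-1 _ (WL (-1) _ _ (fP x) Wc).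
  by rewrite scaleN1r opprB addrA subrK -scalerBl scalerA mulVf// scale1r.
have fL : linear f.
  move=> c u v; apply: f_uniq.
  have := WL c _ _ (fP u) (fP v).
  by rewrite scalerBr scalerA addrACA -opprD -scalerDl.
pose fM := GRing.isLinear.Build k V k^o *:%R f fL.
pose g : {linear V -> k^o} := HB.pack f fM.
by exists g; apply: f_uniq; rewrite scale1r subrr.
Qed.

End Separation.

Section TensorProducts.
Variable k : fieldType.

Lemma tens_neq0 (U V : lmodType k) (u : U) (v : V) : u != 0 -> v != 0 -> u ⊗ v != 0.
Proof.
move=> /exists_functional[f fu] /exists_functional[g gv].
have fgL : bilin (fun (x : U) (y : V) => f x *: g y).
  split=> [y c x x'|x c y y'] /=.
    by rewrite linearP scalerDl scalerA.
  by rewrite linearP scalerDr !scalerA mulrC.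
apply/eqP => /(congr1 (tlift^~ (fun (x : U) (y : V) => f x *: g y)))/=.
rewrite tlift_tens// fu gv scale1r.
by rewrite (lin0 (tlift_linear fgL)) => /eqP; rewrite oner_eq0.
Qed.

(* The external product of two bilinear maps: the multiplication of a tensor
   product of algebras, and its action on a tensor product of modules.        *)
Definition tens2 (U1 V1 W1 U2 V2 W2 : lmodType k)
    (f : U1 -> V1 -> W1) (g : U2 -> V2 -> W2)
    (s : U1 ⊗ U2) (t : V1 ⊗ V2) : W1 ⊗ W2 :=
  Σ[u1, u2 <- s] Σ[v1, v2 <- t] f u1 v1 ⊗ g u2 v2.

Section Tens2.
Variables (U1 V1 W1 U2 V2 W2 : lmodType k).
Variables (f : U1 -> V1 -> W1) (g : U2 -> V2 -> W2).
Hypotheses (fL : bilin f) (gL : bilin g).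

Lemma tens2_inner u1 u2 : bilin (fun v1 v2 => f u1 v1 ⊗ g u2 v2).
Proof.
have [tl tr] := tens_bilin W1 W2.
split=> [v2 c v v'|v1 c v v'] /=; first by rewrite fL.2; exact: tl.
by rewrite gL.2; exact: tr.
Qed.

Lemma tens2_outer t : bilin (fun u1 u2 => Σ[v1, v2 <- t] f u1 v1 ⊗ g u2 v2).
Proof.
have [tl tr] := tens_bilin W1 W2.
split=> [u2|u1].
  apply: (tlift_funP (f := fun u1 v1 v2 => f u1 v1 ⊗ g u2 v2)) => v1 v2 c u u' /=.
  by rewrite (fL.1 v1); exact: tl.
apply: (tlift_funP (f := fun u2 v1 v2 => f u1 v1 ⊗ g u2 v2)) => v1 v2 c u u' /=.
by rewrite (gL.1 v2); exact: tr.
Qed.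

Lemma tens2_bilin : bilin (tens2 f g).
Proof.
split=> [t|s]; first exact: tlift_linear (tens2_outer t).
apply: (tlift_funP (f := fun t u1 u2 => Σ[v1, v2 <- t] f u1 v1 ⊗ g u2 v2)).
by move=> u1 u2; exact: tlift_linear (tens2_inner u1 u2).
Qed.

Lemma tens2E u1 u2 v1 v2 :
  tens2 f g (u1 ⊗ u2) (v1 ⊗ v2) = f u1 v1 ⊗ g u2 v2.
Proof.
rewrite /tens2 tlift_tens; last exact: tens2_outer.
by rewrite tlift_tens//; exact: tens2_inner.
Qed.

End Tens2.

Lemma mul_bilin (A : algType k) : bilin (@GRing.mul A).
Proof.
split=> [a c x y|a c x y] /=; first by rewrite mulrDl scalerAl.
by rewrite mulrDr scalerAr.
Qed.

End TensorProducts.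

Section TensorAlgebra.
Variables (k : fieldType) (A B : algType k).
Implicit Types (x y z : A ⊗ B).

Definition tmul : A ⊗ B -> A ⊗ B -> A ⊗ B := tens2 *%R *%R.
Definition tone : A ⊗ B := 1 ⊗ 1.

Let tmulL : bilin tmul.
Proof. by apply: tens2_bilin; apply: mul_bilin. Qed.

Lemma tmulE (a a' : A) (b b' : B) : tmul (a ⊗ b) (a' ⊗ b') = (a * a') ⊗ (b * b').
Proof. by apply: tens2E; apply: mul_bilin. Qed.

Lemma tmulDl : left_distributive tmul +%R.
Proof. by move=> x y z; apply: (linD (tmulL.1 z)). Qed.

Lemma tmulDr : right_distributive tmul +%R.
Proof. by move=> x y z; apply: (linD (tmulL.2 x)). Qed.

Lemma tmul0 x : tmul 0 x = 0.
Proof. exact: (lin0 (tmulL.1 x)). Qed.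

Lemma tmulx0 x : tmul x 0 = 0.
Proof. exact: (lin0 (tmulL.2 x)). Qed.

Lemma tmulA : associative tmul.
Proof.
move=> x y z; elim/tensor_ind: x => [|x x' IH IH'|a b]; first by rewrite !tmul0.
  by rewrite !tmulDl IH IH'.
elim/tensor_ind: y => [|y y' IH IH'|a' b']; first by rewrite !(tmul0, tmulx0).
  by rewrite !(tmulDl, tmulDr) IH IH'.
elim/tensor_ind: z => [|z z' IH IH'|a'' b'']; first by rewrite !tmulx0.
  by rewrite !tmulDr IH IH'.
by rewrite !tmulE !mulrA.
Qed.

Lemma tmul1 : left_id tone tmul.
Proof.
elim/tensor_ind=> [|x y IHx IHy|a b]; first by rewrite tmulx0.
  by rewrite tmulDr IHx IHy.
by rewrite tmulE !mul1r.
Qed.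

Lemma tmulx1 : right_id tone tmul.
Proof.
elim/tensor_ind=> [|x y IHx IHy|a b]; first by rewrite tmul0.
  by rewrite tmulDl IHx IHy.
by rewrite tmulE !mulr1.
Qed.

Lemma tone_neq0 : tone != 0.
Proof. by apply: tens_neq0; apply: oner_neq0. Qed.

HB.instance Definition _ := GRing.Zmodule_isNzRing.Build (tensor A B)
  tmulA tmul1 tmulx1 tmulDl tmulDr tone_neq0.

Lemma tscaleAl c x y : c *: (x * y) = (c *: x) * y.
Proof. exact/esym/(linZ (tmulL.1 y)). Qed.

Lemma tscaleAr c x y : c *: (x * y) = x * (c *: y).
Proof. exact/esym/(linZ (tmulL.2 x)). Qed.

HB.instance Definition _ := GRing.Lmodule_isLalgebra.Build k (tensor A B) tscaleAl.
HB.instance Definition _ := GRing.Lalgebra_isAlgebra.Build k (tensor A B) tscaleAr.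

End TensorAlgebra.

(* The image of a linear map, as a vector space. *)
Section LinearImage.
Variables (k : fieldType) (U V : lmodType k) (f : {linear U -> V}).

Definition in_limage : {pred V} := fun v => `[< exists u, v = f u >].

Fact in_limage_submod : submod_closed in_limage.
Proof.
split=> [|c v v' /asboolP[u ->] /asboolP[u' ->]]; apply/asboolP.
  by exists 0; rewrite linear0.
by exists (c *: u + u'); rewrite linearP.
Qed.

HB.instance Definition _ := GRing.isSubmodClosed.Build k V in_limage
  in_limage_submod.

Record limage := LImage { limage_val :> V; _ : limage_val \in in_limage }.

HB.instance Definition _ := [isSub for limage_val].
HB.instance Definition _ := [Choice of limage by <:].
HB.instance Definition _ := [SubChoice_isSubLmodule of limage by <:].

Fact to_limage_proof u : f u \in in_limage.
Proof. by apply/asboolP; exists u. Qed.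

Definition to_limage (u : U) : limage := LImage (to_limage_proof u).

End LinearImage.

Reserved Notation "a ▷ m" (at level 40, left associativity).
Reserved Notation "m ◁ a" (at level 40, left associativity).

(* [algType k] requires 1 != 0, which the existence of the counit forces. *)
Record quasiBialgebra (k : fieldType) := QuasiBialgebra {
  qb_alg :> algType k;
  comul : {lrmorphism qb_alg -> qb_alg ⊗ qb_alg};
  counit : {lrmorphism qb_alg -> k | *%R};
  reassoc : qb_alg ⊗ qb_alg ⊗ qb_alg;
  reassoc_inv : qb_alg ⊗ qb_alg ⊗ qb_alg;
  reassocV : reassoc * reassoc_inv = 1;
  reassocVl : reassoc_inv * reassoc = 1;
  reassoc_cocycle :
    (Σ[x, y, z <- reassoc] Σ[z1, z2 <- comul z] x ⊗ y ⊗ z1 ⊗ z2)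
      * (Σ[x, y, z <- reassoc] Σ[x1, x2 <- comul x] x1 ⊗ x2 ⊗ y ⊗ z)
    = (Σ[x, y, z <- reassoc] 1 ⊗ x ⊗ y ⊗ z)
      * (Σ[x, y, z <- reassoc] Σ[y1, y2 <- comul y] x ⊗ y1 ⊗ y2 ⊗ z)
      * (Σ[x, y, z <- reassoc] x ⊗ y ⊗ z ⊗ 1);
  reassoc_counit1 : (Σ[x, y, z <- reassoc] counit x *: (y ⊗ z)) = 1 ⊗ 1;
  reassoc_counit2 : (Σ[x, y, z <- reassoc] counit y *: (x ⊗ z)) = 1 ⊗ 1;
  reassoc_counit3 : (Σ[x, y, z <- reassoc] counit z *: (x ⊗ y)) = 1 ⊗ 1;
  comul_quasi_assoc : forall a,
    (Σ[a1, a2 <- comul a] Σ[b1, b2 <- comul a2] a1 ⊗ b1 ⊗ b2) * reassoc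
    = reassoc * (Σ[a1, a2 <- comul a] Σ[b1, b2 <- comul a1] b1 ⊗ b2 ⊗ a2);
  comul_counitl : forall a, (Σ[a1, a2 <- comul a] counit a1 *: a2) = a;
  comul_counitr : forall a, (Σ[a1, a2 <- comul a] counit a2 *: a1) = a
}.

Arguments comul {k q}.
Arguments counit {k q}.
Arguments reassoc {k}.
Arguments reassoc_inv {k}.

Record preantipode (k : fieldType) (A : quasiBialgebra k) := Preantipode {
  antip :> {linear A -> A};
  antipl : forall a b,
    (Σ[a1, a2 <- comul a] a1 * antip (b * a2)) = counit a *: antip b;
  antipr : forall a b,
    (Σ[a1, a2 <- comul a] antip (a1 * b) * a2) = counit a *: antip b;
  antip_reassoc : (Σ[x, y, z <- reassoc A] x * antip y * z) = 1
}.

Section Modules.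
Variables (k : fieldType) (A : algType k) (M : lmodType k).

Record left_module_axioms (la : A -> M -> M) : Prop := LeftModuleAxioms {
  lact_bilin : bilin la;
  lact1 : forall m, la 1 m = m;
  lactA : forall a b m, la a (la b m) = la (a * b) m
}.

Record right_module_axioms (ra : M -> A -> M) : Prop := RightModuleAxioms {
  ract_bilin : bilin ra;
  ract1 : forall m, ra m 1 = m;
  ractA : forall m a b, ra (ra m a) b = ra m (a * b)
}.

Record bimodule_axioms (la : A -> M -> M) (ra : M -> A -> M) : Prop :=
  BimoduleAxioms {
  bimod_left : left_module_axioms la;
  bimod_right : right_module_axioms ra;
  lractA : forall a m b, ra (la a m) b = la a (ra m b)
}.

End Modules.

Section QuasiHopfBimodules.
Variables (k : fieldType) (A : quasiBialgebra k).

Record qhb_ops (M : lmodType k) := QHBOps {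
  lact : A -> M -> M;
  ract : M -> A -> M;
  coact : M -> M ⊗ A
}.

Section Laws.
Variables (M : lmodType k) (o : qhb_ops M).
Local Notation "a ▷ m" := (lact o a m).
Local Notation "m ◁ a" := (ract o m a).
Local Notation ρ := (coact o).

(* The actions of A ⊗ A ⊗ A on M ⊗ A ⊗ A. *)
Definition lact3 : A ⊗ A ⊗ A -> M ⊗ A ⊗ A -> M ⊗ A ⊗ A :=
  tens2 (tens2 (lact o) *%R) *%R.
Definition ract3 : M ⊗ A ⊗ A -> A ⊗ A ⊗ A -> M ⊗ A ⊗ A :=
  tens2 (tens2 (ract o) *%R) *%R.

Record quasi_hopf_bimodule_axioms : Prop := QuasiHopfBimoduleAxioms {
  qhb_bimodule : bimodule_axioms (lact o) (ract o);
  coact_linear : linear ρ;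
  coact_act : forall a m b,
    ρ (a ▷ m ◁ b) =
      Σ[a1, a2 <- comul a] Σ[m0, m1 <- ρ m] Σ[b1, b2 <- comul b]
        (a1 ▷ m0 ◁ b1) ⊗ (a2 * m1 * b2);
  coact_counit : forall m, (Σ[m0, m1 <- ρ m] counit m1 *: m0) = m;
  coact_quasi_assoc : forall m,
    ract3 (Σ[m0, m1 <- ρ m] Σ[x, y <- comul m1] m0 ⊗ x ⊗ y) (reassoc A)
    = lact3 (reassoc A) (Σ[m0, m1 <- ρ m] ρ m0 ⊗ m1)
}.

End Laws.

Record quasiHopfBimodule := QuasiHopfBimodule {
  qhb_sort :> lmodType k;
  qhb_op :> qhb_ops qhb_sort;
  qhb_axioms : quasi_hopf_bimodule_axioms qhb_op
}.

Section Morphisms.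
Variables (M M' : lmodType k) (o : qhb_ops M) (o' : qhb_ops M').

Record qhb_morphism (f : M -> M') : Prop := QHBMorphism {
  qhb_mor_linear : linear f;
  qhb_mor_lact : forall a m, f (lact o a m) = lact o' a (f m);
  qhb_mor_ract : forall m a, f (ract o m a) = ract o' (f m) a;
  qhb_mor_coact : forall m, coact o' (f m) = Σ[m0, m1 <- coact o m] f m0 ⊗ m1
}.

End Morphisms.

Definition qhb_inverse_isomorphisms (M M' : lmodType k)
    (o : qhb_ops M) (o' : qhb_ops M') (f : M -> M') (g : M' -> M) : Prop :=
  [/\ qhb_morphism o o' f, qhb_morphism o' o g, cancel f g & cancel g f].

End QuasiHopfBimodules.

Section Coinvariants.
Variables (k : fieldType) (A : quasiBialgebra k) (S : preantipode A).
Variable M : quasiHopfBimodule A.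
Local Notation "a ▷ m" := (lact M a m).
Local Notation "m ◁ a" := (ract M m a).
Local Notation ρ := (coact M).

Definition tau (m : M) : M :=
  Σ[x, y, z <- reassoc A] Σ[m0, m1 <- ρ m] x ▷ m0 ◁ (S (y * m1) * z).

Fact tau_linear : linear tau.
Proof.
have [[[laL _ _] [raL _ _] _] ρL _ _ _] := qhb_axioms M.
rewrite /tau; apply: (tlift_funP (f := fun _ _ _ => _)) => xy z.
apply: (tlift_funP (f := fun _ _ _ => _)) => x y c m m' /=.
rewrite ρL; apply: tlift_linear; split=> [m1|m0] d u u' /=.
  by rewrite (laL.2 x) (raL.1 _ d).
rewrite mulrDr -scalerAr linearP mulrDl -scalerAl.
exact: (raL.2 (x ▷ m0)).
Qed.

HB.instance Definition _ := GRing.isLinear.Build k M M *:%R tau tau_linear.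

Definition coinv : lmodType k := limage tau.

Definition coinv_act (a : A) (n : coinv) : coinv := to_limage tau (a ▷ limage_val n).

Local Notation "a ▶ n" := (coinv_act a n) (at level 40, left associativity).

Definition coinv_tensor_ops : qhb_ops A (coinv ⊗ A)%type := {|
  lact := fun a t => Σ[n, b <- t] Σ[a1, a2 <- comul a] (a1 ▶ n) ⊗ (a2 * b);
  ract := fun t a => Σ[n, b <- t] n ⊗ (b * a);
  coact := fun t =>
    Σ[n, b <- t] Σ[x, y, z <- reassoc_inv A] Σ[b1, b2 <- comul b]
      (x ▶ n) ⊗ (y * b1) ⊗ (z * b2)
|}.

Definition nu (t : coinv ⊗ A) : M := Σ[n, a <- t] limage_val n ◁ a.

Definition nu_inv (m : M) : coinv ⊗ A :=
  Σ[m0, m1 <- ρ m] (to_limage tau m0 : coinv) ⊗ m1.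

End Coinvariants.

(* Main.v *)
Require Import Defs.
From mathcomp Require Import all_boot all_algebra.
From mathcomp Require Import boolp.

(** The map [nu_inv : m |-> tau m_0 ⊗ m_1] is shown to be a bijection that
    commutes with both actions and with the coaction; everything else follows.

    Three identities for [tau] carry the argument.  The first axiom of the
    preantipode gives tau (m b) = eps b tau m ([tau_ract]).  Rewriting
    Phi · (m_00 ⊗ m_01 ⊗ m_1) as (m_0 ⊗ m_11 ⊗ m_12) · Phi and applying
    m ⊗ a ⊗ b |-> m S(a) b gives tau m_0 · m_1 = m ([tau_coact]), so
    [nu \o nu_inv] is the identity; the two together give
    tau (a · tau m) = tau (a · m) ([tau_lact_tau]), hence the module structure
    of the coinvariants.  The third identity, tau n_0 ⊗ n_1 = n ⊗ 1 for
    n = tau m ([tau_coact_tau]), is the heart of the matter and makes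
    [nu_inv \o nu] the identity.  Its left-hand side is a functional of
    (Delta ⊗ A ⊗ A)(Phi) that does not change when its argument is multiplied
    on the left by (A ⊗ A ⊗ Delta)(Phi), because the second axiom of the
    preantipode turns that factor into (A ⊗ A ⊗ eps)(Phi) = 1.  The cocycle
    identity therefore replaces (Delta ⊗ A ⊗ A)(Phi) by
    (1 ⊗ Phi) (A ⊗ Delta ⊗ A)(Phi) (Phi ⊗ 1), whose three factors are absorbed
    in turn: the last by quasi-coassociativity of the coaction, the middle one
    by the first axiom of the preantipode, the first by
    Phi^1 S(Phi^2) Phi^3 = 1.

    That [nu_inv] commutes with the structure maps is read off from these
    identities, and the axioms of a quasi-Hopf bimodule on the tensor product
    need no computation of their own: they hold for [M] and pass along any
    linear surjection that respects the operations
    ([qhb_axioms_of_surjection]).  Finally, the inverse of a bijective morphism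
    is a morphism. *)

Set Implicit Arguments.
Unset Strict Implicit.
Unset Printing Implicit Defensive.
Import GRing.Theory.
Local Open Scope ring_scope.

(** * Linearity of Sweedler sums *)

Section Lin.
Variable k : fieldType.
Implicit Types U V W P X : lmodType k.

Lemma linear_comp U V W (h : V -> W) (f : U -> V) :
  linear h -> linear f -> linear (fun x => h (f x)).
Proof. by move=> hL fL c x y; rewrite fL hL. Qed.

Lemma linear_bil_l P U V W (h : U -> V -> W) (f : P -> U) v :
  bilin h -> linear f -> linear (fun x => h (f x) v).
Proof. by move=> hL; apply: (linear_comp (h := h^~ v)); apply: hL.1. Qed.

Lemma linear_bil_r U V W (h : U -> V -> W) u : bilin h -> linear (h u).
Proof. by move=> hL; apply: hL.2. Qed.

Lemma linear_tlift P U V W (t : P -> U ⊗ V) (F : U -> V -> W) :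
  bilin F -> linear t -> linear (fun x => tlift (t x) F).
Proof. by move=> FL; apply: (linear_comp (h := tlift^~ F)); apply: tlift_linear. Qed.

Lemma linear_counit_scale U V (A : quasiBialgebra k) (f : U -> A) (v : V) :
  linear f -> linear (fun x => counit (f x) *: v).
Proof. by move=> fL c x y; rewrite fL linearP scalerDl scalerA. Qed.

Lemma linear_scale U V c (f : U -> V) : linear f -> linear (fun x => c *: f x).
Proof. by move=> fL d x y; rewrite fL scalerDr !scalerA mulrC. Qed.

Lemma bilinP U V W (F : U -> V -> W) :
  (forall v, linear (F^~ v)) -> (forall u, linear (F u)) -> bilin F.
Proof. by []. Qed.

Lemma qhb_lact_bilin (A : quasiBialgebra k) (M : quasiHopfBimodule A) : bilin (lact M).
Proof. by case: (qhb_axioms M) => -[[]]. Qed.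
Lemma qhb_ract_bilin (A : quasiBialgebra k) (M : quasiHopfBimodule A) : bilin (ract M).
Proof. by case: (qhb_axioms M) => -[_ []]. Qed.
Lemma qhb_coact_linear (A : quasiBialgebra k) (M : quasiHopfBimodule A) : linear (coact M).
Proof. by case: (qhb_axioms M). Qed.

Lemma limage_val_linear U V (f : {linear U -> V}) : linear (@limage_val k U V f).
Proof. by []. Qed.
Lemma to_limage_linear U V (f : {linear U -> V}) : linear (to_limage f).
Proof. by move=> c x y; apply: val_inj; rewrite /= linearP. Qed.

Definition trilin U V W X (E : U -> V -> W -> X) : Prop :=
  [/\ forall v w, linear (fun u => E u v w), forall u w, linear (fun v => E u v w)
    & forall u v, linear (E u v)].

Definition quadrilin U V W P X (E : U -> V -> W -> P -> X) : Prop :=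
  (forall p, trilin (fun u v w => E u v w p)) /\ (forall u v w, linear (E u v w)).

Lemma trilin1 P U V W X (E : U -> V -> W -> X) (f : P -> U) v w :
  trilin E -> linear f -> linear (fun p => E (f p) v w).
Proof. by case=> EL _ _; apply: (linear_comp (h := fun u => E u v w)). Qed.

Lemma trilin2 P U V W X (E : U -> V -> W -> X) u (f : P -> V) w :
  trilin E -> linear f -> linear (fun p => E u (f p) w).
Proof. by case=> _ EL _; apply: (linear_comp (h := fun v => E u v w)). Qed.

Lemma trilin3 P U V W X (E : U -> V -> W -> X) u v (f : P -> W) :
  trilin E -> linear f -> linear (fun p => E u v (f p)).
Proof. by case=> _ _ EL; apply: (linear_comp (h := E u v)). Qed.

Lemma trilinP U V W X (E : U -> V -> W -> X) :
  (forall v w, linear (fun u => E u v w)) -> (forall u w, linear (fun v => E u v w)) ->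
  (forall u v, linear (fun w => E u v w)) -> trilin E.
Proof. by []. Qed.

End Lin.

(** [lin] proves that an expression in which the bound variables occur exactly
    once is linear, bilinear or multilinear in them, by recursion on its shape;
    [bilin_op] and [linear_op] deal with the operations at its nodes.  The
    hypotheses of the context serve for operations that are variables. *)
Ltac bilin_op := first
  [ assumption | apply: tens_bilin | apply: mul_bilin
  | apply: qhb_lact_bilin | apply: qhb_ract_bilin ].

Ltac linear_op := first
  [ assumption | apply: qhb_coact_linear | apply: limage_val_linear | apply: to_limage_linear
  | lazymatch goal with |- linear (?h ?a) => apply: (@linear_bil_r _ _ _ _ h a); bilin_op end
  | exact: linearP ].

Ltac lin :=
  cbv beta;
  lazymatch goal with
  | |- _ /\ _ => split; lin
  | |- bilinear_for _ _ _ => apply: bilinP; lin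
  | |- trilin _ => apply: trilinP; lin
  | |- quadrilin _ => split; lin
  | |- linear (fun x => x) => by []
  | |- linear (fun x => tlift (@?t x) (@?F x)) =>
      lazymatch t with
      | fun _ => ?t0 => refine (@tlift_funP _ _ _ _ _ F t0 _); lin
      | _ => lazymatch F with fun _ => ?F0 => apply: (@linear_tlift _ _ _ _ _ t F0); lin end
      end
  | |- linear (fun x => @GRing.scale _ _ (@?c x) (@?g x)) =>
      lazymatch c with
      | fun _ => ?c0 => apply: (@linear_scale _ _ _ c0 g); lin
      | _ => apply: linear_counit_scale; lin
      end
  | _ : trilin ?E |- linear (fun x => ?E (@?f x) (@?g x) (@?h x)) =>
      first [ lazymatch f with fun _ => ?u => lazymatch g with fun _ => ?v =>
                apply: (@trilin3 _ _ _ _ _ _ E u v h) end end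
            | lazymatch f with fun _ => ?u => lazymatch h with fun _ => ?w =>
                apply: (@trilin2 _ _ _ _ _ _ E u g w) end end
            | lazymatch g with fun _ => ?v => lazymatch h with fun _ => ?w =>
                apply: (@trilin1 _ _ _ _ _ _ E f v w) end end ];
      [assumption | lin]
  | |- linear (fun x => ?h (@?f x) (@?g x)) =>
      lazymatch f with
      | fun _ => ?a =>
        lazymatch g with
        | fun x => x => change (linear (h a)); linear_op
        | _ => apply: (@linear_comp _ _ _ _ (h a) g); [linear_op | lin]
        end
      | _ => lazymatch g with fun _ => ?b =>
          apply: (@linear_bil_l _ _ _ _ _ h f b); [bilin_op | lin] end
      end
  | |- linear (fun x => ?h (@?f x)) =>
      lazymatch f with
      | fun x => x => change (linear h); linear_op
      | _ => apply: (@linear_comp _ _ _ _ h f); [linear_op | lin]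
      end
  | |- linear _ => linear_op
  | |- forall _, _ => intro; lin
  end.

(** * Computing with Sweedler sums *)

Section Sweedler.
Variable k : fieldType.
Implicit Types U V W X P : lmodType k.

Lemma eq_tlift U V W (t : U ⊗ V) (F G : U -> V -> W) :
  (forall u v, F u v = G u v) -> tlift t F = tlift t G.
Proof. by move=> FG; apply: eq_bigr. Qed.

(** A Sweedler sum is a finite sum over a representative of the tensor, so this
    holds for every [F], bilinear or not; the same goes for [tlift_tlift] and
    for the exchange of sums. *)
Lemma linear_tliftE U V W X (L : W -> X) (t : U ⊗ V) (F : U -> V -> W) :
  linear L -> L (tlift t F) = Σ[u, v <- t] L (F u v).
Proof.
move=> LL; rewrite /tlift; apply: (big_morph L) => [x y|]; [exact: linD|exact: lin0].
Qed.

Lemma linear_tlift3E U V W P X (L : P -> X) (t : U ⊗ V ⊗ W) (F : U -> V -> W -> P) :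
  linear L -> L (Σ[u, v, w <- t] F u v w) = Σ[u, v, w <- t] L (F u v w).
Proof.
by move=> LL; rewrite linear_tliftE//; apply: eq_tlift => uv w; rewrite linear_tliftE.
Qed.

Lemma tlift_tlift U V U' V' W (t : U ⊗ V) (F : U -> V -> U' ⊗ V') (G : U' -> V' -> W) :
  bilin G -> tlift (tlift t F) G = Σ[u, v <- t] tlift (F u v) G.
Proof. by move=> GL; apply: (linear_tliftE (L := tlift^~ G)); apply: tlift_linear. Qed.

Lemma exchange_tlift U V U' V' W (t : U ⊗ V) (t' : U' ⊗ V') (F : U -> V -> U' -> V' -> W) :
  (Σ[u, v <- t] Σ[u', v' <- t'] F u v u' v') = Σ[u', v' <- t'] Σ[u, v <- t] F u v u' v'.
Proof. exact: exchange_big. Qed.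

Lemma exchange_tlift3 U V U' V' W' W (t : U ⊗ V) (t' : U' ⊗ V' ⊗ W')
    (F : U -> V -> U' -> V' -> W' -> W) :
  (Σ[u, v <- t] Σ[u', v', w' <- t'] F u v u' v' w') =
  Σ[u', v', w' <- t'] Σ[u, v <- t] F u v u' v' w'.
Proof. by rewrite exchange_tlift; apply: eq_tlift => ? ?; rewrite exchange_tlift. Qed.

Lemma trilin_tlift U V W X (E : U -> V -> W -> X) :
  trilin E -> bilin (fun (uv : U ⊗ V) w => tlift uv (fun u v => E u v w)).
Proof.
case=> Eu Ev Ew; apply: bilinP => [w|uv]; first exact: tlift_linear.
exact: tlift_funP.
Qed.

Lemma tlift3_tens U V W X (E : U -> V -> W -> X) u v w :
  trilin E -> (Σ[u, v, w <- u ⊗ v ⊗ w] E u v w) = E u v w.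
Proof.
move=> EL; rewrite tlift_tens; last exact: trilin_tlift.
by rewrite tlift_tens//; case: EL.
Qed.

Lemma tlift_tens2 U1 V1 W1 U2 V2 W2 X (f : U1 -> V1 -> W1) (g : U2 -> V2 -> W2)
    (E : W1 -> W2 -> X) s t :
  bilin E ->
  tlift (tens2 f g s t) E = Σ[u1, u2 <- s] Σ[v1, v2 <- t] E (f u1 v1) (g u2 v2).
Proof.
move=> EL; rewrite /tens2 tlift_tlift//; apply: eq_tlift => u1 u2.
by rewrite tlift_tlift//; apply: eq_tlift => v1 v2; rewrite tlift_tens.
Qed.

Lemma tlift3_tens2 U1 V1 W1 U2 V2 W2 U3 V3 W3 X (f : U1 -> V1 -> W1)
    (g : U2 -> V2 -> W2) (h : U3 -> V3 -> W3) (E : W1 -> W2 -> W3 -> X) s t :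
  trilin E ->
  (Σ[x, y, z <- tens2 (tens2 f g) h s t] E x y z) =
  Σ[u1, u2, u3 <- s] Σ[v1, v2, v3 <- t] E (f u1 v1) (g u2 v2) (h u3 v3).
Proof.
move=> EL; rewrite tlift_tens2; last exact: trilin_tlift.
apply: eq_tlift => u12 u3; rewrite exchange_tlift; apply: eq_tlift => v12 v3.
by rewrite tlift_tens2//; case: EL.
Qed.

Lemma tlift_id U V (t : U ⊗ V) : (Σ[u, v <- t] u ⊗ v) = t.
Proof. by apply/esym/(tlift_uniq (tens_bilin U V) (g := idfun)). Qed.

(** The case of [tlift3_tens2] where the functional is the identity. *)
Lemma tens3E U1 V1 W1 U2 V2 W2 U3 V3 W3 (f : U1 -> V1 -> W1)
    (g : U2 -> V2 -> W2) (h : U3 -> V3 -> W3) s t :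
  tens2 (tens2 f g) h s t =
  Σ[u1, u2, u3 <- s] Σ[v1, v2, v3 <- t] f u1 v1 ⊗ g u2 v2 ⊗ h u3 v3.
Proof.
rewrite -(tlift3_tens2 f g h (E := fun x y z => x ⊗ y ⊗ z) s t); last lin.
rewrite -[LHS]tlift_id; apply: eq_tlift => xy z.
by rewrite -[in LHS](tlift_id xy) (linear_tliftE (L := fun s => s ⊗ z)); last lin.
Qed.

(** Applied twice, this makes [M ⊗ A ⊗ A] a module over the triple tensor power
    of [A], so that the action of [reassoc] can be undone by that of
    [reassoc_inv]. *)
Lemma tens2A U1 U2 (R1 R2 : algType k) (f : R1 -> U1 -> U1) (g : R2 -> U2 -> U2) :
  bilin f -> bilin g ->
  (forall a b u, f a (f b u) = f (a * b) u) ->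
  (forall a b u, g a (g b u) = g (a * b) u) ->
  forall (r s : R1 ⊗ R2) t, tens2 f g r (tens2 f g s t) = tens2 f g (r * s) t.
Proof.
move=> fL gL fA gA r s t; have hL := tens2_bilin fL gL.
elim/tensor_ind: r => [|r r' IHr IHr'|a b].
- by rewrite mul0r !(lin0 (hL.1 _)).
- by rewrite mulrDl !(linD (hL.1 _)) IHr IHr'.
elim/tensor_ind: s => [|s s' IHs IHs'|a' b'].
- by rewrite mulr0 !(lin0 (hL.1 _)) (lin0 (hL.2 _)).
- by rewrite mulrDr !(linD (hL.1 _)) (linD (hL.2 _)) IHs IHs'.
elim/tensor_ind: t => [|t t' IHt IHt'|u v].
- by rewrite !(lin0 (hL.2 _)).
- by rewrite !(linD (hL.2 _)) IHt IHt'.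
have -> : (a ⊗ b) * (a' ⊗ b') = (a * a') ⊗ (b * b') by apply: tmulE.
by rewrite !tens2E// fA gA.
Qed.

Lemma tens2_1 U1 U2 (R1 R2 : algType k) (f : R1 -> U1 -> U1) (g : R2 -> U2 -> U2) :
  bilin f -> bilin g -> (forall u, f 1 u = u) -> (forall u, g 1 u = u) ->
  forall t, tens2 f g 1 t = t.
Proof.
move=> fL gL f1 g1 t; have hL := tens2_bilin fL gL.
elim/tensor_ind: t => [|t t' IHt IHt'|u v].
- exact: lin0 (hL.2 1).
- by rewrite (linD (hL.2 1)) IHt IHt'.
by rewrite (tens2E fL gL) f1 g1.
Qed.

End Sweedler.

(** * The axioms of a quasi-bialgebra in functional form *)

Section QuasiBialgebra.
Variables (k : fieldType) (A : quasiBialgebra k).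
Implicit Types W : lmodType k.

Lemma comul1 : comul (1 : A) = 1 ⊗ 1.
Proof. by rewrite rmorph1. Qed.

Lemma tlift_scale (U V : lmodType k) W c u v (H : U -> V -> W) : bilin H ->
  tlift (c *: (u ⊗ v)) H = c *: H u v.
Proof. by move=> HL; rewrite (linZ (tlift_linear HL)) tlift_tens. Qed.

Lemma reassoc_counitE1 W (H : A -> A -> W) : bilin H ->
  (Σ[x, y, z <- reassoc A] counit x *: H y z) = H 1 1.
Proof.
move=> HL; rewrite -(tlift_tens HL) -reassoc_counit1.
rewrite (linear_tlift3E (L := tlift^~ H)); last exact: tlift_linear.
by do 2!apply: eq_tlift => ? ?; rewrite tlift_scale.
Qed.

Lemma reassoc_counitE3 W (H : A -> A -> W) : bilin H ->
  (Σ[x, y, z <- reassoc A] counit z *: H x y) = H 1 1.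
Proof.
move=> HL; rewrite -(tlift_tens HL) -reassoc_counit3.
rewrite (linear_tlift3E (L := tlift^~ H)); last exact: tlift_linear.
by do 2!apply: eq_tlift => ? ?; rewrite tlift_scale.
Qed.

Lemma reassoc_counitE2 W (H : A -> A -> W) : bilin H ->
  (Σ[x, y, z <- reassoc A] counit y *: H x z) = H 1 1.
Proof.
move=> HL; rewrite -(tlift_tens HL) -reassoc_counit2.
rewrite (linear_tlift3E (L := tlift^~ H)); last exact: tlift_linear.
by do 2!apply: eq_tlift => ? ?; rewrite tlift_scale.
Qed.

Lemma quadrilin_tlift (U V X P : lmodType k) W (E : U -> V -> X -> P -> W) : quadrilin E ->
  bilin (fun uvx p => Σ[u, v, x <- uvx] E u v x p).
Proof.
case=> E3 Ep; apply: bilinP => [p|uvx].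
  exact/tlift_linear/trilin_tlift.
apply: (tlift_funP (f := fun _ _ _ => _)) => uv x.
by apply: (tlift_funP (f := fun _ _ _ => _)) => u v; exact: Ep.
Qed.

(** The cocycle identity after applying an arbitrary 4-linear [E]. *)
Lemma reassoc_cocycleE W (E : A -> A -> A -> A -> W) : quadrilin E ->
  (Σ[x, y, z <- reassoc A] Σ[z1, z2 <- comul z]
   Σ[a, b, c <- reassoc A] Σ[a1, a2 <- comul a]
     E (x * a1) (y * a2) (z1 * b) (z2 * c)) =
  (Σ[p, q, r <- reassoc A]
   Σ[x, y, z <- reassoc A] Σ[y1, y2 <- comul y]
   Σ[a, b, c <- reassoc A]
     E (x * a) (p * y1 * b) (q * y2 * c) (r * z)).
Proof.
move=> EL; have E4 := quadrilin_tlift EL.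
have eval_tens a b c d : tlift (a ⊗ b ⊗ c ⊗ d) (fun uvx p => Σ[u, v, x <- uvx] E u v x p)
    = E a b c d.
  by rewrite tlift_tens// tlift3_tens//; case: EL.
pose ev (s : A ⊗ A ⊗ A ⊗ A) := tlift s (fun uvx p => Σ[u, v, x <- uvx] E u v x p).
have evL : linear ev by exact: tlift_linear.
have evMl t : linear (fun s => ev (s * t)).
  by move=> c x y /=; rewrite mulrDl -scalerAl evL.
have evMr s : linear (fun t => ev (s * t)).
  by move=> c x y /=; rewrite mulrDr -scalerAr evL.
have evMl2 s t : linear (fun r => ev (s * r * t)).
  by move=> c x y /=; rewrite mulrDr mulrDl -scalerAr -scalerAl evL.
have evMl3 s t : linear (fun r => ev (r * s * t)).
  by move=> c x y /=; rewrite !mulrDl -!scalerAl evL.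
have tE (a b c d a' b' c' d' : A) :
    (a ⊗ b ⊗ c ⊗ d) * (a' ⊗ b' ⊗ c' ⊗ d') = (a * a') ⊗ (b * b') ⊗ (c * c') ⊗ (d * d').
  transitivity (((a ⊗ b ⊗ c) * (a' ⊗ b' ⊗ c')) ⊗ (d * d')); first exact: tmulE.
  congr (_ ⊗ _); transitivity (((a ⊗ b) * (a' ⊗ b')) ⊗ (c * c')); first exact: tmulE.
  by congr (_ ⊗ _); apply: tmulE.
transitivity (ev
 ((Σ[x, y, z <- reassoc A] Σ[z1, z2 <- comul z] x ⊗ y ⊗ z1 ⊗ z2) *
  (Σ[x, y, z <- reassoc A] Σ[x1, x2 <- comul x] x1 ⊗ x2 ⊗ y ⊗ z))).
  rewrite (linear_tlift3E (L := fun s => ev (s * _)))//.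
  do 2!apply: eq_tlift => ? ?; rewrite (linear_tliftE (L := fun s => ev (s * _)))//.
  apply: eq_tlift => ? ?; rewrite (linear_tlift3E (L := fun s => ev (_ * s)))//.
  do 2!apply: eq_tlift => ? ?; rewrite (linear_tliftE (L := fun s => ev (_ * s)))//.
  by apply: eq_tlift => ? ?; rewrite tE /ev eval_tens.
rewrite reassoc_cocycle (linear_tlift3E (L := fun s => ev (s * _ * _)))//.
do 2!apply: eq_tlift => ? ?; rewrite (linear_tlift3E (L := fun s => ev (_ * s * _)))//.
do 2!apply: eq_tlift => ? ?; rewrite (linear_tliftE (L := fun s => ev (_ * s * _)))//.
apply: eq_tlift => ? ?; rewrite (linear_tlift3E (L := fun s => ev (_ * s)))//.
by do 2!apply: eq_tlift => ? ?; rewrite !tE /ev eval_tens !mul1r !mulr1.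
Qed.

End QuasiBialgebra.

(** * The projection onto the coinvariants *)

Section Coinvariants.
Variables (k : fieldType) (A : quasiBialgebra k) (S : preantipode A).
Variable M : quasiHopfBimodule A.
Local Notation "a ▷ m" := (lact M a m).
Local Notation "m ◁ a" := (ract M m a).
Local Notation ρ := (coact M).
Local Notation τ := (@tau k A S M).
Local Notation ε := counit.
Local Notation Δ := comul.
Local Notation Φ := (reassoc A).
Implicit Types (m : M) (a b : A) (W : lmodType k).

Lemma qhb_lact1 m : 1 ▷ m = m.
Proof. by case: (qhb_axioms M) => -[[]]. Qed.
Lemma qhb_lactA a b m : a ▷ (b ▷ m) = (a * b) ▷ m.
Proof. by case: (qhb_axioms M) => -[[]]. Qed.
Lemma qhb_ract1 m : m ◁ 1 = m.
Proof. by case: (qhb_axioms M) => -[_ []]. Qed.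
Lemma qhb_ractA m a b : m ◁ a ◁ b = m ◁ (a * b).
Proof. by case: (qhb_axioms M) => -[_ []]. Qed.
Lemma qhb_lractA a m b : a ▷ m ◁ b = a ▷ (m ◁ b).
Proof. by case: (qhb_axioms M) => -[]. Qed.

Lemma coact_lractE W (F : M -> A -> W) a m b : bilin F ->
  tlift (ρ (a ▷ m ◁ b)) F =
  Σ[a1, a2 <- Δ a] Σ[m0, m1 <- ρ m] Σ[b1, b2 <- Δ b] F (a1 ▷ m0 ◁ b1) (a2 * m1 * b2).
Proof.
move=> FL; have [_ _ -> _ _] := qhb_axioms M; rewrite tlift_tlift//.
apply: eq_tlift => a1 a2; rewrite tlift_tlift//; apply: eq_tlift => m0 m1.
by rewrite tlift_tlift//; apply: eq_tlift => b1 b2; rewrite tlift_tens.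
Qed.

Lemma coact_ractE W (F : M -> A -> W) m b : bilin F ->
  tlift (ρ (m ◁ b)) F = Σ[m0, m1 <- ρ m] Σ[b1, b2 <- Δ b] F (m0 ◁ b1) (m1 * b2).
Proof.
move=> FL; rewrite -{1}[m]qhb_lact1 coact_lractE// comul1.
rewrite (@tlift_tens _ _ _ _ (fun a1 a2 =>
  Σ[m0, m1 <- ρ m] Σ[b1, b2 <- Δ b] F (a1 ▷ m0 ◁ b1) (a2 * m1 * b2))).
  by do 2!apply: eq_tlift => ? ?; rewrite qhb_lact1 mul1r.
lin.
Qed.

Lemma coact_lactE W (F : M -> A -> W) a m : bilin F ->
  tlift (ρ (a ▷ m)) F = Σ[a1, a2 <- Δ a] Σ[m0, m1 <- ρ m] F (a1 ▷ m0) (a2 * m1).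
Proof.
move=> FL; rewrite -[a ▷ m]qhb_ract1 coact_lractE// comul1.
do 2!apply: eq_tlift => ? ?.
rewrite (@tlift_tens _ _ _ _ (fun b1 b2 => F (_ ▷ _ ◁ b1) (_ * _ * b2))).
  by rewrite qhb_ract1 mulr1.
lin.
Qed.

Lemma antiplE W (L : A -> W) a b : linear L ->
  (Σ[a1, a2 <- Δ a] L (a1 * S (b * a2))) = ε a *: L (S b).
Proof. by move=> LL; rewrite -linear_tliftE// antipl (linZ LL). Qed.

Lemma antiprE W (L : A -> W) a b : linear L ->
  (Σ[a1, a2 <- Δ a] L (S (a1 * b) * a2)) = ε a *: L (S b).
Proof. by move=> LL; rewrite -linear_tliftE// antipr (linZ LL). Qed.

Lemma antip_reassocE W (L : A -> W) : linear L ->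
  (Σ[x, y, z <- Φ] L (x * S y * z)) = L 1.
Proof. by move=> LL; rewrite -linear_tlift3E// antip_reassoc. Qed.

(** This is a_1 S(b a_2) = eps a S(b) with b = Phi^2 m_1. *)
Lemma tau_ract m a : τ (m ◁ a) = ε a *: τ m.
Proof.
rewrite /tau (linear_tlift3E (L := *:%R _)); last lin.
do 2!apply: eq_tlift => ? ?; rewrite coact_ractE; last lin.
rewrite linear_tliftE; last lin.
apply: eq_tlift => m0 m1; rewrite -(antiplE (L := fun s => _ ▷ m0 ◁ (s * _))); last lin.
by apply: eq_tlift => b1 b2; rewrite -qhb_lractA qhb_ractA !mulrA.
Qed.

Lemma coact_counitE W (L : M -> W) m : linear L ->
  (Σ[m0, m1 <- ρ m] ε m1 *: L m0) = L m.
Proof.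
move=> LL; have [_ _ _ cu _] := qhb_axioms M.
by rewrite -{2}[m]cu linear_tliftE//; apply: eq_tlift => ? ?; rewrite (linZ LL).
Qed.

(** Quasi-coassociativity after applying an arbitrary trilinear [E]. *)
Lemma coact_quasi_assocE W (E : M -> A -> A -> W) m : trilin E ->
  (Σ[m0, m1 <- ρ m] Σ[u, v <- Δ m1] Σ[x, y, z <- Φ] E (m0 ◁ x) (u * y) (v * z)) =
  (Σ[x, y, z <- Φ] Σ[m0, m1 <- ρ m] Σ[m00, m01 <- ρ m0] E (x ▷ m00) (y * m01) (z * m1)).
Proof.
move=> EL; have [_ _ _ _ qa] := qhb_axioms M.
have := congr1 (tlift^~ (fun uv w => tlift uv (fun u v => E u v w))) (qa m) => /=.
rewrite !tlift3_tens2// tlift_tlift; last by apply: trilin_tlift; lin.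
move=> qaE; apply: etrans (etrans qaE _).
  apply: eq_tlift => m0 m1; rewrite tlift_tlift; last by apply: trilin_tlift; lin.
  by apply: eq_tlift => u v; rewrite tlift3_tens//; lin.
do 2!apply: eq_tlift => ? ?; rewrite tlift_tlift; last by apply: trilin_tlift; lin.
by apply: eq_tlift => m0 m1; rewrite tlift_tens; last by apply: trilin_tlift; lin.
Qed.

(** Quasi-coassociativity moves Phi to the right of m_0 ⊗ m_11 ⊗ m_12; then
    S(m_11 Phi^2) m_12 = eps(m_1) S(Phi^2), and what remains is
    Phi^1 S(Phi^2) Phi^3 = 1. *)
Lemma tau_coact m : (Σ[m0, m1 <- ρ m] τ m0 ◁ m1) = m.
Proof.
pose E m a b := m ◁ (S a * b).
transitivity (Σ[x, y, z <- Φ] Σ[m0, m1 <- ρ m] Σ[m00, m01 <- ρ m0]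
    E (x ▷ m00) (y * m01) (z * m1)).
  rewrite -exchange_tlift3; apply: eq_tlift => m0 m1.
  rewrite (linear_tlift3E (L := fun s => s ◁ m1)); last lin.
  do 2!apply: eq_tlift => ? ?; rewrite (linear_tliftE (L := fun s => s ◁ m1)); last lin.
  by apply: eq_tlift => ? ?; rewrite /E qhb_ractA mulrA.
rewrite -coact_quasi_assocE; last by rewrite /E; lin.
rewrite -[RHS](coact_counitE (L := id))//; apply: eq_tlift => m0 m1.
rewrite exchange_tlift3.
transitivity (Σ[x, y, z <- Φ] ε m1 *: (m0 ◁ (x * S y * z))).
  do 2!apply: eq_tlift => ? ?.
  rewrite -(antiprE (L := fun s => m0 ◁ (_ * s * _))); last lin.
  by apply: eq_tlift => ? ?; rewrite /E qhb_ractA !mulrA.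
by rewrite (antip_reassocE (L := fun s => ε m1 *: (m0 ◁ s))) ?qhb_ract1//; lin.
Qed.

(** Apply tau (a · _) to m = tau m_0 · m_1: by [tau_ract] the factor m_1 turns
    into eps m_1. *)
Lemma tau_lact_tau a m : τ (a ▷ τ m) = τ (a ▷ m).
Proof.
rewrite -{2}[m]tau_coact.
rewrite (linear_tliftE (L := fun s => τ (a ▷ s))); last lin.
rewrite -(coact_counitE (L := fun s => τ (a ▷ τ s))); last lin.
by apply: eq_tlift => m0 m1; rewrite -qhb_lractA tau_ract.
Qed.

Lemma tau_tau m : τ (τ m) = τ m.
Proof. by have := tau_lact_tau 1 m; rewrite !qhb_lact1. Qed.

Lemma comul_counitlE W (L : A -> W) a : linear L ->
  (Σ[a1, a2 <- Δ a] ε a1 *: L a2) = L a.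
Proof.
move=> LL; rewrite -{2}[a]comul_counitl linear_tliftE//.
by apply: eq_tlift => ? ?; rewrite (linZ LL).
Qed.

Lemma comulME W (F : A -> A -> W) a b : bilin F ->
  tlift (Δ (a * b)) F = Σ[a1, a2 <- Δ a] Σ[b1, b2 <- Δ b] F (a1 * b1) (a2 * b2).
Proof. by move=> FL; rewrite rmorphM -(@tlift_tens2 _ _ _ _ _ _ _ _ *%R *%R F). Qed.

(** * The map nu_inv sends a coinvariant n to n ⊗ 1 *)

Section TauCoact.

(** By [tau_ract], tau n_0 ⊗ n_1 for n = tau m is the value of the 4-linear
    functional [T m] at (Delta ⊗ A ⊗ A)(Phi). *)
Let T m (w x y z : A) : M ⊗ A :=
  Σ[m0, m1 <- ρ m] Σ[m00, m01 <- ρ m0] τ (w ▷ m00) ⊗ (x * m01 * (S (y * m1) * z)).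

Let T_quadrilin m : quadrilin (T m).
Proof. rewrite /T; lin. Qed.

(** The second axiom of the preantipode: a factor Delta a on the left of the
    last two entries of [T m] collapses to eps a. *)
Let T_comul m u v b c a :
  (Σ[a1, a2 <- Δ a] T m u v (a1 * b) (a2 * c)) = ε a *: T m u v b c.
Proof.
rewrite /T (linear_tliftE (L := fun s => ε a *: s)); last lin.
rewrite exchange_tlift; apply: eq_tlift => m0 m1.
rewrite (linear_tliftE (L := fun s => ε a *: s)); last lin.
rewrite exchange_tlift; apply: eq_tlift => m00 m01.
rewrite -(antiprE (L := fun s => τ (u ▷ m00) ⊗ (v * m01 * (s * c)))); last lin.
by apply: eq_tlift => a1 a2; rewrite !mulrA.
Qed.

(** A factor Phi ⊗ 1 on the right disappears: quasi-coassociativity moves it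
    inside [tau], where [tau_ract] reduces it to (eps ⊗ A ⊗ A)(Phi) = 1. *)
Let T_reassoc m w x y z :
  (Σ[a, b, c <- Φ] T m (w * a) (x * b) (y * c) z) =
  Σ[m0, m1 <- ρ m] Σ[s, t <- Δ m1] τ (w ▷ m0) ⊗ (x * s * (S (y * t) * z)).
Proof.
pose F n s t := τ (w ▷ n) ⊗ (x * s * (S (y * t) * z)).
have FL : trilin F by rewrite /F; lin.
transitivity (Σ[a, b, c <- Φ] Σ[m0, m1 <- ρ m] Σ[m00, m01 <- ρ m0]
    F (a ▷ m00) (b * m01) (c * m1)).
  by do 4!apply: eq_tlift => ? ?; rewrite /F qhb_lactA !mulrA.
rewrite -coact_quasi_assocE//; apply: eq_tlift => m0 m1; apply: eq_tlift => s t.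
transitivity (F m0 (s * 1) (t * 1)); last by rewrite /F !mulr1.
rewrite -(reassoc_counitE1 (H := fun b c => F m0 (s * b) (t * c))); last lin.
do 2!apply: eq_tlift => ? ?; rewrite /F -qhb_lractA tau_ract.
by rewrite (linZ ((tens_bilin _ _).1 _)).
Qed.

Lemma tau_coact_tau m : (Σ[n0, n1 <- ρ (τ m)] τ n0 ⊗ n1) = τ m ⊗ 1.
Proof.
transitivity (Σ[x, y, z <- Φ] Σ[x1, x2 <- Δ x] T m x1 x2 y z).
  rewrite {1}/tau (linear_tlift3E (L := fun n => Σ[n0, n1 <- ρ n] τ n0 ⊗ n1)); last lin.
  do 2!apply: eq_tlift => ? ?; rewrite [RHS]exchange_tlift.
  rewrite (linear_tliftE (L := fun n => Σ[n0, n1 <- ρ n] τ n0 ⊗ n1)); last lin.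
  apply: eq_tlift => ? ?; rewrite coact_lractE; last lin.
  do 2!apply: eq_tlift => ? ?.
  rewrite -(comul_counitlE (L := fun c => τ _ ⊗ (_ * c))); last lin.
  apply: eq_tlift => ? ?; rewrite tau_ract.
  by rewrite (linZ ((tens_bilin _ _).1 _)).
(* Multiplying the argument of T m on the left by (A ⊗ A ⊗ Delta)(Phi)
   changes nothing, and creates the left-hand side of the cocycle identity. *)
transitivity (Σ[x, y, z <- Φ] Σ[z1, z2 <- Δ z] Σ[a, b, c <- Φ] Σ[a1, a2 <- Δ a]
    T m (x * a1) (y * a2) (z1 * b) (z2 * c)).
  pose H x y := Σ[a, b, c <- Φ] Σ[a1, a2 <- Δ a] T m (x * a1) (y * a2) b c.
  transitivity (H 1 1).
    by do 3!apply: eq_tlift => ? ?; rewrite !mul1r.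
  rewrite -reassoc_counitE3; last by rewrite /H /T; lin.
  do 2!apply: eq_tlift => ? ?; rewrite exchange_tlift3.
  rewrite /H (linear_tlift3E (L := fun s => ε _ *: s)); last lin.
  do 2!apply: eq_tlift => ? ?; rewrite exchange_tlift.
  rewrite (linear_tliftE (L := fun s => ε _ *: s)); last lin.
  by apply: eq_tlift => ? ?; rewrite T_comul.
rewrite reassoc_cocycleE; last exact: T_quadrilin.
(* p ⊗ q ⊗ r is the factor 1 ⊗ Phi; it remains to absorb the middle factor
   (A ⊗ Delta ⊗ A)(Phi), whose middle leg meets m_1 in y_1 m_11 S(q y_2 m_12). *)
rewrite -[in RHS](antip_reassocE (L := fun s => τ m ⊗ s)); last lin.
apply: eq_tlift => pq r; apply: eq_tlift => p q.
transitivity (Σ[x, y, z <- Φ] ε y *: (τ (x ▷ m) ⊗ (p * (S q) * (r * z)))); last first.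
  rewrite (reassoc_counitE2 (H := fun x z => τ (x ▷ m) ⊗ (p * (S q) * (r * z)))); last lin.
  by rewrite qhb_lact1 mulr1.
apply: eq_tlift => xy z; apply: eq_tlift => x y.
transitivity (Σ[m0, m1 <- ρ m] Σ[y1, y2 <- Δ y] Σ[s, t <- Δ m1]
    τ (x ▷ m0) ⊗ (p * ((y1 * s) * (S (q * (y2 * t)))) * (r * z))).
  rewrite [RHS]exchange_tlift; apply: eq_tlift => y1 y2; rewrite T_reassoc.
  by do 2!apply: eq_tlift => ? ?; rewrite !mulrA.
rewrite -(coact_counitE (L := fun m0 => ε y *: (τ (x ▷ m0) ⊗ _))); last lin.
apply: eq_tlift => m0 m1.
rewrite -(comulME (F := fun a1 a2 => τ (x ▷ m0) ⊗ (p * (a1 * (S (q * a2))) * (r * z)))); last lin.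
rewrite (antiplE (L := fun s => τ (x ▷ m0) ⊗ (p * s * (r * z)))); last lin.
by rewrite rmorphM scalerA mulrC.
Qed.

End TauCoact.

Lemma coinv_val (n : coinv S M) : τ (limage_val n) = limage_val n.
Proof. by case: n => n /= /asboolP[m ->]; rewrite tau_tau. Qed.

Lemma to_limage_tau m : to_limage τ (τ m) = to_limage τ m.
Proof. by apply: val_inj; rewrite /= tau_tau. Qed.

(** Quasi-coassociativity solved for m_00 ⊗ m_01 ⊗ m_1. *)
Lemma coact_quasi_assoc_invE W (E : M -> A -> A -> W) m : trilin E ->
  (Σ[x, y, z <- reassoc_inv A] Σ[m0, m1 <- ρ m] Σ[u, v <- Δ m1] Σ[a, b, c <- Φ]
     E (x ▷ (m0 ◁ a)) (y * (u * b)) (z * (v * c))) =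
  Σ[m0, m1 <- ρ m] Σ[m00, m01 <- ρ m0] E m00 m01 m1.
Proof.
move=> EL.
have [[[laL la1 laA] _ _] _ _ _ qa] := qhb_axioms M.
have mulL := mul_bilin A.
have uE : (Σ[m0, m1 <- ρ m] ρ m0 ⊗ m1) =
    lact3 M (reassoc_inv A) (ract3 M (Σ[m0, m1 <- ρ m] Σ[x, y <- Δ m1] m0 ⊗ x ⊗ y) Φ).
  rewrite qa /lact3 tens2A; first last.
  - by move=> a b c; rewrite mulrA.
  - by apply: tens2A => // a b c; rewrite mulrA.
  - exact: mul_bilin.
  - by apply: tens2_bilin.
  rewrite reassocVl tens2_1 //; first exact: tens2_bilin.
    by apply: tens2_1 => // a; rewrite mul1r.
  by move=> a; rewrite mul1r.
transitivity (Σ[u, v, w <- Σ[m0, m1 <- ρ m] ρ m0 ⊗ m1] E u v w); last first.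
  rewrite tlift_tlift; last exact: trilin_tlift.
  by apply: eq_tlift => ? ?; rewrite tlift_tens//; exact: trilin_tlift.
rewrite uE /lact3 tlift3_tens2//; do 2!apply: eq_tlift => ? ?.
rewrite /ract3 tlift3_tens2; last lin.
rewrite tlift_tlift; last by apply: trilin_tlift; lin.
apply: eq_tlift => ? ?; rewrite tlift_tlift; last by apply: trilin_tlift; lin.
by apply: eq_tlift => ? ?; rewrite tlift3_tens; last lin.
Qed.

(** * The maps nu and nu_inv *)

Lemma coinv_act_module : left_module_axioms (@coinv_act k A S M).
Proof.
split=> [|n|a b n].
- apply: bilinP => [n|a] c x y; apply: val_inj; rewrite /=.
    by rewrite ((qhb_lact_bilin M).1 _ c) linearP.
  by rewrite ((qhb_lact_bilin M).2 _ c) linearP.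
- by apply: val_inj; rewrite /= qhb_lact1 coinv_val.
- by apply: val_inj; rewrite /= tau_lact_tau qhb_lactA.
Qed.

Lemma coinv_act_bilin : bilin (@coinv_act k A S M).
Proof. by case: coinv_act_module. Qed.

Lemma coinv_act_to_limage a m : coinv_act a (to_limage τ m) = to_limage τ (a ▷ m).
Proof. by apply: val_inj; rewrite /= tau_lact_tau. Qed.

Lemma to_limage_ract m a : to_limage τ (m ◁ a) = ε a *: (to_limage τ m : coinv S M).
Proof. by apply: val_inj; rewrite /= tau_ract. Qed.

Local Notation o := (coinv_tensor_ops S M).
Local Notation ν' := (@nu_inv k A S M).

Lemma nu_inv_linear : linear ν'.
Proof. rewrite /nu_inv; lin. Qed.

Lemma nu_linear : linear (@nu k A S M).
Proof. rewrite /nu; lin. Qed.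

Lemma nu_inv_lact a m : ν' (a ▷ m) = lact o a (ν' m).
Proof.
have caL := coinv_act_bilin.
rewrite /nu_inv /= tlift_tlift; last lin.
rewrite coact_lactE; last lin.
rewrite exchange_tlift; apply: eq_tlift => m0 m1.
rewrite tlift_tens; last lin.
by apply: eq_tlift => a1 a2; rewrite coinv_act_to_limage.
Qed.

Lemma nu_inv_ract m a : ν' (m ◁ a) = ract o (ν' m) a.
Proof.
rewrite /nu_inv /= tlift_tlift; last lin.
rewrite coact_ractE; last lin.
apply: eq_tlift => m0 m1; rewrite tlift_tens; last lin.
rewrite -(comul_counitlE (L := fun s => to_limage τ m0 ⊗ (m1 * s))); last lin.
by apply: eq_tlift => a1 a2; rewrite to_limage_ract (linZ ((tens_bilin _ _).1 _)).
Qed.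

(** Expressing m_00 ⊗ m_01 ⊗ m_1 as Phi^-1 · (m_0 ⊗ m_11 ⊗ m_12) · Phi, the
    factor Phi on the right is killed by [tau], and Phi^-1 is the coaction of
    the tensor product. *)
Lemma nu_inv_coact m : coact o (ν' m) = Σ[m0, m1 <- ρ m] ν' m0 ⊗ m1.
Proof.
have caL := coinv_act_bilin.
pose E n b c : coinv S M ⊗ A ⊗ A := to_limage τ n ⊗ b ⊗ c.
have EL : trilin E by rewrite /E; lin.
transitivity (Σ[m0, m1 <- ρ m] Σ[m00, m01 <- ρ m0] E m00 m01 m1); last first.
  apply: eq_tlift => m0 m1.
  by rewrite (linear_tliftE (L := fun s => s ⊗ m1)); last lin.
rewrite -coact_quasi_assoc_invE// -exchange_tlift3 /nu_inv /= tlift_tlift; last lin.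
apply: eq_tlift => m0 m1; rewrite tlift_tens; last lin.
apply: eq_tlift => xy z; apply: eq_tlift => x y; apply: eq_tlift => u v.
transitivity (E (x ▷ m0) (y * (u * 1)) (z * (v * 1))).
  by rewrite /E !mulr1 coinv_act_to_limage.
rewrite -(reassoc_counitE1 (H := fun b c => E (x ▷ m0) (y * (u * b)) (z * (v * c)))); last lin.
do 2!apply: eq_tlift => ? ?; rewrite /E -qhb_lractA to_limage_ract.
by rewrite (linZ ((tens_bilin _ _).1 _)) (linZ ((tens_bilin _ _).1 _)).
Qed.

Lemma nu_invK : cancel ν' (@nu k A S M).
Proof.
move=> m; rewrite /nu_inv /nu tlift_tlift; last lin.
rewrite -[RHS]tau_coact; apply: eq_tlift => m0 m1.
by rewrite tlift_tens; last lin.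
Qed.

Lemma nu_inv_val (n : coinv S M) : ν' (limage_val n) = n ⊗ 1.
Proof.
have [m nE] : exists m, limage_val n = τ m by exists (limage_val n); rewrite coinv_val.
have -> : n = to_limage τ m by apply: val_inj.
have := congr1 (tlift^~ (fun n a => (to_limage τ n : coinv S M) ⊗ a)) (tau_coact_tau m).
rewrite /= tlift_tlift; last lin.
rewrite tlift_tens; last lin.
rewrite to_limage_tau => <-; apply: eq_tlift => n0 n1.
by rewrite tlift_tens ?to_limage_tau //; lin.
Qed.

Lemma nuK : cancel (@nu k A S M) ν'.
Proof.
elim/tensor_ind=> [|s t IHs IHt|n a].
- by rewrite (lin0 nu_linear) (lin0 nu_inv_linear).
- by rewrite (linD nu_linear) (linD nu_inv_linear) IHs IHt.
rewrite /nu tlift_tens; last lin.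
rewrite nu_inv_ract nu_inv_val /= tlift_tens; last lin.
by rewrite mul1r.
Qed.

End Coinvariants.

(** * Transport of the axioms along a surjection *)

Section Transport.
Variables (k : fieldType) (A : quasiBialgebra k) (M : quasiHopfBimodule A).
Variables (M' : lmodType k) (o : qhb_ops A M') (g : M -> M').
Hypotheses (gM : qhb_morphism M o g) (gs : forall t, exists m, t = g m).

(** Every axiom is an identity between expressions that [g] carries to the same
    expressions in [M'], and every element of [M'] is in the image of [g]. *)
Lemma qhb_axioms_of_surjection : quasi_hopf_bimodule_axioms o.
Proof.
have [gL gl gr gc] := gM.
have [[[laL la1 laA] [raL ra1 raA] lra] rL act cu qa] := qhb_axioms M.
have laL' : bilin (lact o).
  apply: bilinP => [t c a b|a c t u].
    by have [m ->] := gs t; rewrite -!gl laL.1 gL.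
  by have [m ->] := gs t; have [n ->] := gs u; rewrite -gL -!gl laL.2 gL.
have raL' : bilin (ract o).
  apply: bilinP => [a c t u|t c a b].
    by have [m ->] := gs t; have [n ->] := gs u; rewrite -gL -!gr raL.1 gL.
  by have [m ->] := gs t; rewrite -!gr raL.2 gL.
have coL : linear (coact o).
  move=> c t u; have [m ->] := gs t; have [n ->] := gs u.
  by rewrite -gL !gc rL; apply: tlift_linear; lin.
split.
- split; [split=> //|split=> //|].
  + by move=> t; have [m ->] := gs t; rewrite -gl la1.
  + by move=> a b t; have [m ->] := gs t; rewrite -!gl laA.
  + by move=> t; have [m ->] := gs t; rewrite -gr ra1.
  + by move=> t a b; have [m ->] := gs t; rewrite -!gr raA.
  + by move=> a t b; have [m ->] := gs t; rewrite -gl -!gr -gl lra.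
- exact: coL.
- move=> a t b; have [m ->] := gs t; rewrite -gl -gr !gc coact_lractE; last lin.
  apply: eq_tlift => a1 a2; rewrite tlift_tlift; last lin.
  apply: eq_tlift => m0 m1; rewrite tlift_tens; last lin.
  by apply: eq_tlift => b1 b2; rewrite gr gl.
- move=> t; have [m ->] := gs t; rewrite gc tlift_tlift; last lin.
  rewrite -[in RHS](cu m) linear_tliftE//; apply: eq_tlift => m0 m1.
  by rewrite tlift_tens ?(linZ gL)//; lin.
move=> t; have [m ->] := gs t.
pose E u (b c : A) := g u ⊗ b ⊗ c.
have EL : trilin E by rewrite /E; lin.
apply: etrans (etrans (coact_quasi_assocE m EL) _).
  rewrite gc /ract3 tens3E tlift_tlift; last lin.
  rewrite tlift_tlift; last by apply: trilin_tlift; lin.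
  apply: eq_tlift => m0 m1.
  rewrite tlift_tens; last lin.
  rewrite tlift_tlift; last by apply: trilin_tlift; lin.
  apply: eq_tlift => u v; rewrite tlift3_tens; last lin.
  by do 2!apply: eq_tlift => ? ?; rewrite /E gr.
rewrite gc /lact3 tens3E; do 2!apply: eq_tlift => ? ?.
rewrite tlift_tlift; last lin.
rewrite tlift_tlift; last by apply: trilin_tlift; lin.
apply: eq_tlift => m0 m1; rewrite tlift_tens; last lin.
rewrite tlift_tens; last by apply: trilin_tlift; lin.
rewrite gc tlift_tlift; last lin.
by apply: eq_tlift => ? ?; rewrite tlift_tens /E ?gl//; lin.
Qed.

End Transport.

(** * The structure theorem *)

Theorem corollary3p15 (k : fieldType) (A : quasiBialgebra k)
    (S : preantipode A) (M : quasiHopfBimodule A) :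
  [/\ left_module_axioms (@coinv_act k A S M),
      quasi_hopf_bimodule_axioms (coinv_tensor_ops S M)
    & qhb_inverse_isomorphisms (coinv_tensor_ops S M) (qhb_op M)
        (@nu k A S M) (@nu_inv k A S M)].
Proof.
have nuVK := @nu_invK k A S M; have nuK := @nuK k A S M.
have nuL := @nu_linear k A S M.
have nuVM : qhb_morphism (qhb_op M) (coinv_tensor_ops S M) (@nu_inv k A S M).
  split; [exact: nu_inv_linear|exact: nu_inv_lact|exact: nu_inv_ract|].
  exact: nu_inv_coact.
split; first exact: coinv_act_module.
  by apply: (qhb_axioms_of_surjection nuVM) => t; exists (nu t).
split=> //; split=> // [a t|t a|t].
- by apply: (can_inj nuVK); rewrite nu_inv_lact !nuK.
- by apply: (can_inj nuVK); rewrite nu_inv_ract !nuK.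
rewrite -{2}[t]nuK nu_inv_coact tlift_tlift; last lin.
rewrite -[LHS]tlift_id; apply: eq_tlift => m0 m1.
by rewrite tlift_tens ?nuVK//; lin.
Qed.
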